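(* Consider a nonatomic mixed-autonomy congestion game with cost function drawn from the class $\mathcal{C}_{k,\sigma}$, and let $\xi(\sigma)=\sigma(\sigma+1)^{-\frac{\sigma+1}{\sigma}}$. Let $z^{\mathrm{EQ}}$ be an equilibrium for this game. If $q^{\mathrm{OPT}}$ is a social optimum for the same game with $1+k\,\xi(\sigma)$ times as much flow demand of each type (i.e. every human-driven demand and every autonomous demand is multiplied by $1+k\,\xi(\sigma)$), then $$C(z^{\mathrm{EQ}})\le C(q^{\mathrm{OPT}}).$$
   Context: Game: a directed network with $n$ roads (links) and $m$ origin-destination pairs; the $j$-th pair has demand $\alpha_j\ge 0$ of human-driven flow and $\beta_j\ge 0$ of autonomous flow. Drivers are nonatomic. A routing is a vector $z=(x_1,y_1,\ldots,x_n,y_n)\in\mathbb{R}_{\ge 0}^{2n}$, where $x_i,y_i$ are the human-driven and autonomous flows on road $i$; it is feasible if it routes all demand of both types from origins to destinations, respecting conservation of flow. Both vehicle types on road $i$ experience latency $c_i(x_i,y_i)$. The social cost is $C(z)=\sum_{i=1}^n c_i(x_i,y_i)(x_i+y_i)$. A (Wardrop) equilibrium is a feasible routing in which all users sharing an origin and destination use paths of equal latency and no unused path has smaller latency. A social optimum is a feasible routing minimizing $C$. Cost functions: the latency on road $i$ is $$c_i(x_i,y_i)=t_i\Big(1+\rho_i\Big(\tfrac{x_i+y_i}{m_i(x_i,y_i)}\Big)^{\sigma_i}\Big),\qquad t_i\ge 0,\ \rho_i\ge 0,\ \sigma_i\ge 1,$$ where, with $\alpha(x_i,y_i)=y_i/(x_i+y_i)$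 and constants $d_i,h_i,\bar h_i>0$ (road length, nonplatooned spacing, platooned spacing; no order between $h_i$ and $\bar h_i$ is assumed), the capacity $m_i$ is given by either capacity model 1, $$m_i(x_i,y_i)=\frac{d_i}{\alpha(x_i,y_i)\bar h_i+(1-\alpha(x_i,y_i))h_i},$$ or capacity model 2, $$m_i(x_i,y_i)=\frac{d_i}{\alpha^2(x_i,y_i)\bar h_i+(1-\alpha^2(x_i,y_i))h_i}.$$ At $x_i=y_i=0$ the quotient $(x_i+y_i)/m_i(x_i,y_i)$ is taken to be $0$. The maximum degree of asymmetry is $k=\max_{i}\max(h_i/\bar h_i,\ \bar h_i/h_i)$ and the maximum polynomial degree is $\sigma=\max_i\sigma_i$ (maxima over all roads). $\mathcal{C}_{k,\sigma}$ is the class of network cost functions whose road latencies are $c_i(x_i,y_i)=t_i\big(1+\rho_i\big(\tfrac{x_i+y_i}{m_i(x_i,y_i)}\big)^{\sigma_i}\big)$ with $t_i\ge 0$, $\rho_i\ge 0$, $\sigma_i\ge 1$ and $m_i$ given by capacity model 1 or capacity model 2, with maximum degree of asymmetry $k$ and maximum polynomial degree $\sigma$. *)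

(* Defs.v *)
From HB Require Import structures.
From mathcomp Require Import all_boot all_order all_algebra.
From mathcomp Require Import reals exp.
Set Implicit Arguments.
Unset Strict Implicit.
Unset Printing Implicit Defensive.
Import Order.TTheory GRing.Theory Num.Theory.
Local Open Scope ring_scope.

(* A directed network with roads 'I_n (parallel roads are allowed) and
   origin-destination pairs 'I_m. *)
Record network (n m : nat) := Network {
  node : finType;
  tail : 'I_n -> node;
  head : 'I_n -> node;
  orig : 'I_m -> node;
  dest : 'I_m -> node }.

(* (z i).1 is the human-driven flow x_i and (z i).2 the autonomous flow y_i. *)
Definition routing (R : realType) (n : nat) := 'I_n -> R * R.

Definition human (R : realType) n (z : routing R n) (i : 'I_n) : R := (z i).1.
Definition auton (R : realType) n (z : routing R n) (i : 'I_n) : R := (z i).2.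

Section Flows.
Variables (R : realType) (n m : nat) (G : network n m).

(* x is the total road flow of nonnegative flows f j, one for each
   origin-destination pair, where f j satisfies Kirchhoff's law: the net outflow
   is dem j at the origin, - dem j at the destination, and 0 at other nodes. *)
Definition routes (dem : 'I_m -> R) (x : 'I_n -> R) : Prop :=
  exists f : 'I_m -> 'I_n -> R,
    [/\ forall j i, 0 <= f j i,
        forall j v, \sum_(i | tail G i == v) f j i -
                    \sum_(i | head G i == v) f j i =
                    dem j * ((v == orig G j)%:R - (v == dest G j)%:R)
      & forall i, x i = \sum_j f j i].

Definition feasible (alpha beta : 'I_m -> R) (z : routing R n) : Prop :=
  routes alpha (human z) /\ routes beta (auton z).

Fixpoint walk (u v : node G) (p : seq 'I_n) : bool :=
  if p is i :: p' then (tail G i == u) && walk (head G i) v p' else u == v.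

(* Paths visit no node twice, so they use at most n roads and n.-bseq 'I_n
   contains all of them. *)
Definition od_path (j : 'I_m) (p : n.-bseq 'I_n) : bool :=
  walk (orig G j) (dest G j) p && uniq (orig G j :: map (head G) p).

Definition path_flow (dem : 'I_m -> R) (x : 'I_n -> R)
    (F : 'I_m -> n.-bseq 'I_n -> R) : Prop :=
  [/\ forall j p, 0 <= F j p,
      forall j, \sum_(p | od_path j p) F j p = dem j
    & forall i, x i = \sum_j \sum_(p | od_path j p && (i \in val p)) F j p].

Variable c : 'I_n -> R -> R -> R.

Definition path_latency (z : routing R n) (p : n.-bseq 'I_n) : R :=
  \sum_(i <- p) c i (human z i) (auton z i).

(* F and G' are the distributions of the human-driven and autonomous users over
   paths; a path is used by pair j if users of either type travel on it. *)
Definition equilibrium (alpha beta : 'I_m -> R) (z : routing R n) : Prop :=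
  feasible alpha beta z /\
  exists F G' : 'I_m -> n.-bseq 'I_n -> R,
    let used j p := 0 < F j p \/ 0 < G' j p in
    [/\ path_flow alpha (human z) F,
        path_flow beta (auton z) G',
        forall j p q, od_path j p -> od_path j q -> used j p -> used j q ->
          path_latency z p = path_latency z q
      & forall j p q, od_path j p -> od_path j q -> used j p -> ~ used j q ->
          path_latency z p <= path_latency z q].

Definition social_cost (z : routing R n) : R :=
  \sum_i c i (human z i) (auton z i) * (human z i + auton z i).

Definition social_optimum (alpha beta : 'I_m -> R) (z : routing R n) : Prop :=
  feasible alpha beta z /\
  forall z', feasible alpha beta z' -> social_cost z <= social_cost z'.

End Flows.

Section Latencies.
Variable R : realType.

Inductive capacity_model := Model1 | Model2.

Record road := Road {
  free_time : R;         (* t_i *)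
  congestion : R;        (* rho_i *)
  degree : R;            (* sigma_i *)
  road_length : R;       (* d_i *)
  spacing : R;           (* h_i *)
  platoon_spacing : R;   (* \bar h_i *)
  model : capacity_model }.

Definition valid_road (r : road) : Prop :=
  [/\ 0 <= free_time r, 0 <= congestion r & 1 <= degree r] /\
  [/\ 0 < road_length r, 0 < spacing r & 0 < platoon_spacing r].

Definition autonomy_level (x y : R) : R := y / (x + y).

Definition capacity (r : road) (x y : R) : R :=
  let a := autonomy_level x y in
  match model r with
  | Model1 => road_length r / (a * platoon_spacing r + (1 - a) * spacing r)
  | Model2 =>
      road_length r / (a ^+ 2 * platoon_spacing r + (1 - a ^+ 2) * spacing r)
  end.

(* On an empty road autonomy_level is 0 / 0 = 0, so the capacity is nonzero and
   the base of the power is 0. *)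
Definition latency (r : road) (x y : R) : R :=
  free_time r *
    (1 + congestion r * ((x + y) / capacity r x y) `^ degree r).

Definition asymmetry (r : road) : R :=
  Num.max (spacing r / platoon_spacing r) (platoon_spacing r / spacing r).

(* The entries of both maxima are positive, so the default 0 is only reached on
   a network without roads. *)
Definition cost_class (k sigma : R) (n : nat) (c : 'I_n -> R -> R -> R) : Prop :=
  exists r : 'I_n -> road,
    [/\ forall i, valid_road (r i),
        k = \big[Num.max/0]_i asymmetry (r i),
        sigma = \big[Num.max/0]_i degree (r i)
      & forall i x y, 0 <= x -> 0 <= y -> c i x y = latency (r i) x y].

Definition xi (sigma : R) : R :=
  sigma * (sigma + 1) `^ (- ((sigma + 1) / sigma)).

End Latencies.

(* Main.v *)
Require Import Defs.
From mathcomp Require Import all_boot all_order all_algebra.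
From mathcomp Require Import reals exp.
From mathcomp Require Import hoelder ring lra.
Set Implicit Arguments.
Unset Strict Implicit.
Unset Printing Implicit Defensive.
Import Order.TTheory GRing.Theory Num.Theory.
Local Open Scope ring_scope.

(** Write |z| for the total (human plus autonomous) flow of z on a road, and
    c(z) for the latency.  The proof is a smoothness argument in two halves.

    On one road (lemma [latency_increment_le]), the latency at z exceeds the
    latency at any other flow q by so little that
      (c(z) - c(q)) |q| <= k xi(sigma) c(z) |z|.
    Indeed c is an increasing function of the occupied length S |z|, where the
    mean spacing S lies between the two spacings of the road, so that the
    spacings at z and at q differ by a factor at most k.  Measuring flows by the
    length they occupy costs this factor k and leaves a statement about one real
    variable, (a^s - b^s) b <= xi(sigma) a^(s+1) with s <= sigma.  After
    division by a^(s+1) it bounds u (1 - u^s), and such a bound is an instance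
    of Young's inequality.

    On the network (lemma [equilibrium_variational]), freeze the latencies at
    their equilibrium values.  Every equilibrium user travels on a path that is
    shortest for the frozen latencies, so any routing of lam times the demands
    has frozen cost at least lam C(z).  An edge flow subject to Kirchhoff's law
    may contain cycles; a node potential (distance from the origin) bounds
    its cost below without a decomposition into paths.

    With lam = 1 + k xi(sigma) and q routing the scaled demands, summing the
    road inequality gives
      lam C(z) - C(q) <= sum c(z) |q| - C(q) <= k xi(sigma) C(z),
    which is C(z) <= C(q). *)

(** * The latency of one road *)

Section OneRoad.
Variable R : realType.
Implicit Types (r : road R) (s u a b k sigma x y p q : R).

Lemma xi_ge0 s : 0 <= s -> 0 <= xi s.
Proof. by move=> s0; rewrite mulr_ge0 ?powR_ge0. Qed.

(** The maximum of u (1 - u^s) is attained at u = (s + 1)^(-1/s).  Young's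
    inequality for the product of u (s + 1)^(1/s) with 1, with exponents s + 1
    and (s + 1) / s, is an equality at that point and gives the bound without
    calculus. *)
Lemma xi_bound s u : 0 < s -> 0 <= u -> u * (1 - u `^ s) <= xi s.
Proof.
move=> s0 u0; have s1 : 0 < s + 1 by lra.
have sN0 : s != 0 by rewrite gt_eqF.
have s1N0 : s + 1 != 0 by rewrite gt_eqF.
set w := (s + 1) `^ s^-1.
have w0 : 0 < w by rewrite powR_gt0.
have wN0 : w != 0 by rewrite gt_eqF.
have wE : w `^ s = s + 1 by rewrite /w -powRrM mulVf // powRr1 // ltW.
have xiE : xi s = s / ((s + 1) * w).
  rewrite /xi powRN; congr (_ / _).
  have -> : (s + 1) / s = 1 + s^-1 by field.
  by rewrite powRD ?s1N0 ?implybT // powRr1 // ltW.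
have uw0 : 0 <= u * w by rewrite mulr_ge0 // ltW.
have c0 : 0 < (s + 1) / s by rewrite divr_gt0.
have c1 : (s + 1)^-1 + ((s + 1) / s)^-1 = 1 by field; rewrite sN0.
have := conjugate_powR uw0 ler01 s1 c0 c1.
rewrite mulr1 powR1 powRD ?s1N0 ?implybT; last first.
  by rewrite implybE s1N0.
rewrite powRr1 ?mulr_ge0 ?(ltW w0) // powRM ?(ltW w0) // wE => young.
rewrite xiE ler_pdivlMr ?mulr_gt0 //.
set U := u `^ s in young *.
have -> : u * (1 - U) * ((s + 1) * w) =
   (s + 1) * (u * w - (U * (s + 1)) * (u * w) / (s + 1)) by field.
have sE : (s + 1) * (1 / ((s + 1) / s)) = s by field; rewrite sN0.
by rewrite -[X in _ <= X]sE ler_pM2l //; lra.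
Qed.

(** Homogeneous form of the previous bound.  For b <= a, the ratio u = b / a is
    at most 1, so u^sigma <= u^s: raising the exponent s to the maximal degree
    sigma only increases u (1 - u^s).  This replaces monotonicity of xi. *)
Lemma powR_increment_le s sigma a b :
  1 <= s -> s <= sigma -> 0 <= a -> 0 <= b ->
  (a `^ s - b `^ s) * b <= xi sigma * (a `^ s * a).
Proof.
move=> s1 ssig a0 b0.
have s0 : 0 < s by lra.
have xi0 : 0 <= xi sigma by apply/xi_ge0/ltW/(lt_le_trans s0).
have rhs0 : 0 <= xi sigma * (a `^ s * a).
  by rewrite mulr_ge0 // mulr_ge0 // powR_ge0.
have [ab|ba] := leP a b.
  apply: le_trans rhs0; rewrite mulr_le0_ge0 // subr_le0.
  by apply: ge0_ler_powR => //; rewrite ltW.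
have agt0 : 0 < a by apply: le_lt_trans ba.
pose u := b / a.
have u0 : 0 <= u by rewrite divr_ge0.
have u1 : u <= 1 by rewrite ler_pdivrMr // mul1r ltW.
have -> : b = u * a by rewrite /u divfK // gt_eqF.
rewrite powRM // -[X in X - _]mul1r -mulrBl.
have -> : (1 - u `^ s) * a `^ s * (u * a) = u * (1 - u `^ s) * (a `^ s * a).
  by ring.
rewrite ler_wpM2r ?mulr_ge0 ?powR_ge0 //.
apply: le_trans (xi_bound _ u0); last lra.
rewrite ler_wpM2l // lerD2l lerN2.
have [u00|un0] := eqVneq u 0.
  by rewrite u00 !powR0 // gt_eqF //; lra.
by apply: ger_powR => //; rewrite u1 lt_neqAle eq_sym un0 u0.
Qed.

(** In both capacity models this is a weighted mean of the two spacings. *)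
Definition mean_spacing r x y := road_length r / capacity r x y.

Lemma autonomy_level_itv x y : 0 <= x -> 0 <= y -> 0 <= autonomy_level x y <= 1.
Proof.
move=> x0 y0; rewrite /autonomy_level divr_ge0 ?addr_ge0 //=.
have [->|xy0] := eqVneq (x + y) 0; first by rewrite invr0 mulr0.
rewrite ler_pdivrMr ?mul1r; last by rewrite lt_neqAle eq_sym xy0 addr_ge0.
lra.
Qed.

Lemma mean_spacing_itv r x y : valid_road r -> 0 <= x -> 0 <= y ->
  Num.min (spacing r) (platoon_spacing r) <= mean_spacing r x y
    <= Num.max (spacing r) (platoon_spacing r).
Proof.
move=> [_ [d0 h0 hb0]] x0 y0; have /andP[a0 a1] := autonomy_level_itv x0 y0.
(* Both models are convex combinations;
   w is the autonomy level or its square. *)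
have convex w : 0 <= w <= 1 ->
  Num.min (spacing r) (platoon_spacing r)
    <= road_length r / (road_length r /
         (w * platoon_spacing r + (1 - w) * spacing r))
    <= Num.max (spacing r) (platoon_spacing r).
  move=> /andP[w0 w1]; rewrite invf_div mulrC divfK ?gt_eqF //.
  rewrite ge_min le_max.
  case: (leP (spacing r) (platoon_spacing r)) => h.
    apply/andP; split; apply/orP; [left|right]; nra.
  apply/andP; split; apply/orP; [right|left]; nra.
rewrite /mean_spacing /capacity; case: (model r); apply: convex.
  by rewrite a0 a1.
by rewrite exprn_ge0 // exprn_ile1.
Qed.

Lemma mean_spacing_gt0 r x y : valid_road r -> 0 <= x -> 0 <= y ->
  0 < mean_spacing r x y.
Proof.
move=> vr x0 y0; have /andP[+ _] := mean_spacing_itv vr x0 y0.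
by apply: lt_le_trans; case: vr => _ [_ h0 hb0]; rewrite lt_min h0.
Qed.

Lemma mean_spacing_asymmetry r x y p q : valid_road r ->
  0 <= x -> 0 <= y -> 0 <= p -> 0 <= q ->
  mean_spacing r x y <= asymmetry r * mean_spacing r p q.
Proof.
move=> vr x0 y0 p0 q0.
have /andP[_ le_max] := mean_spacing_itv vr x0 y0.
have /andP[min_le _] := mean_spacing_itv vr p0 q0.
case: vr => _ [_ h0 hb0]; apply: le_trans le_max _.
have asym0 : 0 <= asymmetry r by rewrite /asymmetry le_max divr_ge0 // ltW.
apply: le_trans (ler_wpM2l asym0 min_le).
rewrite /asymmetry; case: (leP (spacing r) (platoon_spacing r)) => h.
  by rewrite -ler_pdivrMr // le_max lexx orbT.
by rewrite -ler_pdivrMr // le_max lexx.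
Qed.

(** The argument of the power is the fraction of the road that is occupied,
    which makes it comparable across different autonomy levels. *)
Lemma latencyE r x y : valid_road r ->
  latency r x y = free_time r * (1 + congestion r *
    ((x + y) * mean_spacing r x y / road_length r) `^ degree r).
Proof.
move=> [_ [d0 _ _]]; rewrite /latency /mean_spacing.
by rewrite mulrA mulrAC mulfK // gt_eqF.
Qed.

Lemma latency_ge0 r x y : valid_road r -> 0 <= latency r x y.
Proof.
by move=> [[t0 rho0 _] _]; rewrite mulr_ge0 // addr_ge0 // mulr_ge0 ?powR_ge0.
Qed.

(** The smoothness inequality.  With occupancies a = |z| S / d and
    b = |q| T / d, the flow |q| equals b (d / T), and |z| = a (d / S) is at least
    a (d / T) / k because S <= k T; so the bound on powers, multiplied by d / T,
    suffices.  The constant part of the latency cancels on the left and only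
    helps on the right. *)
Lemma latency_increment_le r k sigma x y p q : valid_road r ->
  asymmetry r <= k -> degree r <= sigma ->
  0 <= x -> 0 <= y -> 0 <= p -> 0 <= q ->
  (latency r x y - latency r p q) * (p + q)
    <= k * xi sigma * (latency r x y * (x + y)).
Proof.
move=> vr le_k le_sigma x0 y0 p0 q0.
have S0 := mean_spacing_gt0 vr x0 y0.
have T0 := mean_spacing_gt0 vr p0 q0.
have ST : mean_spacing r x y <= k * mean_spacing r p q.
  apply: le_trans (mean_spacing_asymmetry vr x0 y0 p0 q0) _.
  by rewrite ler_wpM2r // ltW.
rewrite !latencyE //; case: vr => [[t0 rho0 s1] [d0 _ _]].
move: (mean_spacing r x y) (mean_spacing r p q) S0 T0 ST => S T S0 T0 ST.
set a := (x + y) * S / road_length r; set b := (p + q) * T / road_length r.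
have a0 : 0 <= a by rewrite !mulr_ge0 ?addr_ge0 ?invr_ge0 // ltW.
have b0 : 0 <= b by rewrite !mulr_ge0 ?addr_ge0 ?invr_ge0 // ltW.
have xi0 : 0 <= xi sigma by apply: xi_ge0; lra.
have k0 : 0 <= k by rewrite -(pmulr_lge0 _ T0); lra.
have incr := powR_increment_le s1 le_sigma a0 b0.
have pqE : p + q = b * (road_length r / T).
  by rewrite /b; field; rewrite !gt_eqF.
have axy : a * (road_length r / T) <= k * (x + y).
  have -> : a * (road_length r / T) = S / T * (x + y).
    by rewrite /a; field; rewrite !gt_eqF.
  by rewrite ler_wpM2r ?addr_ge0 // ler_pdivrMr.
have dT : 0 <= road_length r / T by rewrite divr_ge0 // ltW.
set A := a `^ degree r in incr *; set B := b `^ degree r in incr *.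
have A0 : 0 <= A by apply: powR_ge0.
have key : (A - B) * (p + q) <= k * xi sigma * (A * (x + y)).
  rewrite pqE mulrA; apply: le_trans (ler_wpM2r dT incr) _.
  have -> : xi sigma * (A * a) * (road_length r / T) =
            xi sigma * A * (a * (road_length r / T)) by ring.
  have -> : k * xi sigma * (A * (x + y)) = xi sigma * A * (k * (x + y)) by ring.
  by rewrite ler_wpM2l // mulr_ge0.
have -> : (free_time r * (1 + congestion r * A) -
   free_time r * (1 + congestion r * B)) * (p + q) =
  free_time r * congestion r * ((A - B) * (p + q)) by ring.
apply: le_trans (ler_wpM2l (mulr_ge0 t0 rho0) key) _.
have -> : k * xi sigma * (free_time r * (1 + congestion r * A) * (x + y)) =
  free_time r * congestion r * (k * xi sigma * (A * (x + y)))
   + k * xi sigma * free_time r * (x + y) by ring.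
rewrite lerDl; apply: mulr_ge0; last exact: addr_ge0.
by rewrite mulr_ge0 // mulr_ge0.
Qed.

End OneRoad.

(** * Edge flows cost at least the shortest-path distance *)

Section Walks.
Variables (R : realType) (n m : nat) (G : network n m) (l : 'I_n -> R).
Hypothesis l_ge0 : forall i, 0 <= l i.
Implicit Types (u v w : node G) (p q : seq 'I_n).

Definition walk_cost p : R := \sum_(i <- p) l i.

Definition simple u v p := walk u v p && uniq (u :: map (Defs.head G) p).

Lemma simple_size u v p : simple u v p -> (size p <= n)%N.
Proof.
move=> /andP[_ /= /andP[_ /map_uniq p_uniq]].
by rewrite -[X in (_ <= X)%N]card_ord -(card_uniqP p_uniq) max_card.
Qed.

(** Cutting off the loop that a walk makes when it revisits u. *)
Lemma simple_suffix u w v p : simple w v p -> u \in w :: map (Defs.head G) p ->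
  exists2 q, simple u v q & walk_cost q <= walk_cost p.
Proof.
elim: p w => [|i p IHp] w.
  by rewrite inE => wv /eqP ->; exists [::].
have [-> |uw] := eqVneq u w; first by exists (i :: p).
move=> /andP[/= /andP[_ wp] /andP[_ up]].
rewrite inE (negPf uw) /= => u_in.
have [|q qs le_q] := IHp (Defs.head G i) _ u_in; first exact/andP.
by exists q => //; apply: le_trans le_q _; rewrite /walk_cost big_cons lerDr.
Qed.

Lemma walk_simple u v p : walk u v p ->
  exists2 q, simple u v q & walk_cost q <= walk_cost p.
Proof.
elim: p u => [|i p IHp] u /=.
  by move=> uv; exists [::]; rewrite // /simple /= uv.
move=> /andP[tail_i /IHp[q qs le_q]].
have le_iq : walk_cost (i :: q) <= walk_cost (i :: p).
  by rewrite /walk_cost !big_cons lerD2l.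
have [u_in|u_out] := boolP (u \in Defs.head G i :: map (Defs.head G) q).
  have [q' q's le_q'] := simple_suffix qs u_in.
  exists q' => //; apply: le_trans le_q' _; apply: le_trans le_iq.
  by rewrite /walk_cost big_cons lerDr.
exists (i :: q) => //; move/andP: qs => [wq uq].
by rewrite /simple /= tail_i wq u_out.
Qed.

Lemma walk_rcons u p i :
  walk u (tail G i) p -> walk u (Defs.head G i) (rcons p i).
Proof.
elim: p u => [|j p IHp] u /=; first by rewrite eq_sym => ->; rewrite eqxx.
by move=> /andP[-> /IHp].
Qed.

(** The distance from u to v, truncated at M so that it is finite at nodes that
    cannot be reached from u.  Only simple paths compete, so that the
    minimum is over a finite set; by [walk_simple], no walk is shorter. *)
Definition potential (M : R) u v : R :=
  \big[Num.min/M]_(p : n.-bseq 'I_n | simple u v p) walk_cost p.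

Lemma potential_le M u v p : simple u v p -> potential M u v <= walk_cost p.
Proof.
move=> ps; pose P := Bseq (simple_size ps).
by apply: (bigmin_le_cond _ (j := P)).
Qed.

Lemma potential_step M u i :
  potential M u (Defs.head G i) <= potential M u (tail G i) + l i.
Proof.
rewrite -lerBlDr; apply/bigmin_geP; split.
  rewrite lerBlDr; apply: le_trans (bigmin_le_id _ _ _ _) _.
  by rewrite lerDl.
move=> p /andP[/walk_rcons/walk_simple[q qs le_q] _]; rewrite lerBlDr.
apply: le_trans (potential_le M qs) _; apply: le_trans le_q _.
by rewrite /walk_cost -cats1 big_cat big_seq1.
Qed.

Lemma sum_by_node (f : 'I_n -> R) (phi : node G -> R) (h : 'I_n -> node G) :
  \sum_v phi v * \sum_(i | h i == v) f i = \sum_i phi (h i) * f i.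
Proof.
rewrite [RHS](partition_big h xpredT) //=; apply: eq_bigr => v _.
by rewrite mulr_sumr; apply: eq_bigr => i /eqP ->.
Qed.

(** Linear programming duality for shortest paths.  By [potential_step] the cost
    of the flow is at least the sum over roads of flow times increase of the
    potential; by Kirchhoff's law that sum telescopes to d times the potential
    difference between t and o, and truncating at L makes this difference at
    least L even if t cannot be reached from o. *)
Lemma flow_cost_ge (f : 'I_n -> R) (d L : R) (o t : node G) :
  (forall i, 0 <= f i) -> 0 <= d -> 0 <= L ->
  (forall v, \sum_(i | tail G i == v) f i - \sum_(i | Defs.head G i == v) f i =
             d * ((v == o)%:R - (v == t)%:R)) ->
  (forall p : n.-bseq 'I_n, simple o t p -> L <= walk_cost p) ->
  d * L <= \sum_i l i * f i.
Proof.
move=> f0 d0 L0 kirchhoff minL; pose phi := potential L o.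
have phi_t : L <= phi t by apply/bigmin_geP.
have phi_o : phi o <= 0.
  have os : simple o o [::] by rewrite /simple /= eqxx.
  by have := potential_le L os; rewrite /walk_cost big_nil.
have work : d * (phi t - phi o) =
    \sum_i (phi (Defs.head G i) - phi (tail G i)) * f i.
  have -> : \sum_i (phi (Defs.head G i) - phi (tail G i)) * f i =
      - \sum_v phi v * (d * ((v == o)%:R - (v == t)%:R)).
    under eq_bigr do rewrite mulrBl.
    rewrite sumrB -!sum_by_node -sumrB -sumrN; apply: eq_bigr => v _.
    by rewrite -kirchhoff -mulrBr -mulrN opprB.
  have pick w : \sum_v phi v * (v == w)%:R = phi w.
    rewrite (bigD1 w) //= eqxx mulr1 big1 ?addr0 // => v /negPf ->.
    by rewrite mulr0.
  rewrite -[in LHS](pick t) -[in LHS](pick o) -sumrB mulr_sumr -sumrN.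
  by apply: eq_bigr => v _; ring.
apply: (@le_trans _ _ (d * (phi t - phi o))).
  by rewrite ler_wpM2l //; lra.
rewrite work; apply: ler_sum => i _; rewrite ler_wpM2r //.
by rewrite lerBlDl; apply: potential_step.
Qed.

Lemma routes_cost_ge (dem L : 'I_m -> R) (x : 'I_n -> R) :
  (forall j, 0 <= dem j) -> (forall j, 0 <= L j) ->
  (forall j (p : n.-bseq 'I_n), od_path G j p -> L j <= walk_cost p) ->
  routes G dem x -> \sum_j dem j * L j <= \sum_i l i * x i.
Proof.
move=> dem0 L0 minL [f [f0 kirchhoff xE]].
under [X in _ <= X]eq_bigr do rewrite xE mulr_sumr.
rewrite exchange_big; apply: ler_sum => j _.
by apply: (flow_cost_ge (f0 j) _ _ (kirchhoff j)) => //; apply: minL.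
Qed.

(** Exchanging the sums over roads and over paths charges each user the cost of
    the path travelled; each road counts once because a simple path uses it at
    most once. *)
Lemma path_flow_cost (dem L : 'I_m -> R) (x : 'I_n -> R) F :
  (forall j (p : n.-bseq 'I_n), od_path G j p -> 0 < F j p ->
     walk_cost p = L j) ->
  path_flow G dem x F -> \sum_i l i * x i = \sum_j dem j * L j.
Proof.
move=> costE [F0 demE xE].
under eq_bigr do rewrite xE mulr_sumr.
rewrite exchange_big; apply: eq_bigr => j _ /=.
rewrite -demE mulr_suml.
under eq_bigr do rewrite mulr_sumr big_mkcondr.
rewrite exchange_big; apply: eq_bigr => p odp /=.
transitivity (F j p * walk_cost p).
  have p_uniq : uniq p.
    by move/andP: odp => [_ /= /andP[_ /map_uniq]].
  rewrite -big_mkcond /walk_cost -(big_uniq _ p_uniq) mulr_sumr.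
  by apply: eq_bigr => i _; rewrite mulrC.
have [->|Fn0] := eqVneq (F j p) 0; first by rewrite !mul0r.
by rewrite (costE j) // lt_neqAle eq_sym Fn0 F0.
Qed.

End Walks.

(** * The variational inequality at an equilibrium *)

Section Equilibrium.
Variables (R : realType) (n m : nat) (G : network n m).
Variable c : 'I_n -> R -> R -> R.

Lemma routes_ge0 (dem : 'I_m -> R) x : routes G dem x -> forall i, 0 <= x i.
Proof. by move=> [f [f0 _ xE]] i; rewrite xE sumr_ge0. Qed.

(** For each pair the used paths have a common latency L j, which is minimal
    among all paths of the pair.  Hence the equilibrium pays exactly L j per
    unit of demand of either type, and any routing pays at least that. *)
Lemma equilibrium_variational (alpha beta : 'I_m -> R) (lam : R) z q :
  (forall j, 0 <= alpha j) -> (forall j, 0 <= beta j) -> 0 <= lam ->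
  (forall i, 0 <= c i (human z i) (auton z i)) ->
  equilibrium G c alpha beta z ->
  feasible G (fun j => lam * alpha j) (fun j => lam * beta j) q ->
  lam * social_cost c z
    <= \sum_i c i (human z i) (auton z i) * (human q i + auton q i).
Proof.
move=> alpha0 beta0 lam0 c0.
move=> [_ [F [F' [Fflow F'flow eq_used le_unused]]]] [qh qa].
pose l i := c i (human z i) (auton z i).
pose usedb j p := (0 < F j p) || (0 < F' j p).
(* A pair without used paths has no demand; any nonnegative value below the
   latencies of its paths would do, and 0 is one. *)
pose L j := if [pick p | od_path G j p && usedb j p] is Some p
            then walk_cost l p else 0.
have len0 p : 0 <= walk_cost l p by apply: sumr_ge0 => i _; apply: c0.
have L0 j : 0 <= L j by rewrite /L; case: pickP.
have minL j p : od_path G j p -> L j <= walk_cost l p.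
  rewrite /L; case: pickP => // p0 /andP[od0 /orP used0] od.
  have [/orP used|unused] := boolP (usedb j p).
    have := eq_used j p0 p od0 od used0 used.
    by rewrite /path_latency /walk_cost => ->.
  apply: (le_unused j p0 p) => //; exact/orP.
have usedL j p : od_path G j p -> usedb j p -> walk_cost l p = L j.
  move=> od used; rewrite /L; case: pickP => [p0 /andP[od0 /orP used0]|].
    by apply: (eq_used j) => //; apply/orP.
  by move=> /(_ p); rewrite od used.
have costz : social_cost c z =
    \sum_j alpha j * L j + \sum_j beta j * L j.
  rewrite -(path_flow_cost (l := l) _ Fflow); last first.
    by move=> j p od Fp; apply: usedL; rewrite // /usedb Fp.
  rewrite -(path_flow_cost (l := l) _ F'flow); last first.
    by move=> j p od Fp; apply: usedL; rewrite // /usedb Fp orbT.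
  by rewrite -big_split; apply: eq_bigr => i _; rewrite /= -mulrDr.
under [X in _ <= X]eq_bigr do rewrite mulrDr.
have scale (d : 'I_m -> R) :
    lam * (\sum_j d j * L j) = \sum_j lam * d j * L j.
  by rewrite mulr_sumr; apply: eq_bigr => j _; rewrite mulrA.
rewrite big_split costz mulrDr !scale.
by apply: lerD; apply: (routes_cost_ge (G := G) c0) => // j; apply: mulr_ge0.
Qed.

End Equilibrium.

(** * Comparison with the optimum of the scaled demands *)

Theorem theorem3 (R : realType) (n m : nat) (G : network n m)
    (alpha beta : 'I_m -> R) (k sigma : R) (c : 'I_n -> R -> R -> R)
    (zEQ qOPT : routing R n) :
  (forall j, 0 <= alpha j) ->
  (forall j, 0 <= beta j) ->
  cost_class k sigma c ->
  equilibrium G c alpha beta zEQ ->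
  social_optimum G c (fun j => (1 + k * xi sigma) * alpha j)
                     (fun j => (1 + k * xi sigma) * beta j) qOPT ->
  social_cost c zEQ <= social_cost c qOPT.
Proof.
move=> alpha0 beta0 [r [vr kE sigmaE cE]] eqz [feasq _].
have [zh za] : (forall i, 0 <= human zEQ i) /\ (forall i, 0 <= auton zEQ i).
  by case: eqz => -[/routes_ge0 zh /routes_ge0 za] _.
have [qh qa] : (forall i, 0 <= human qOPT i) /\ (forall i, 0 <= auton qOPT i).
  by case: feasq => [/routes_ge0 qh /routes_ge0 qa].
have le_k i : asymmetry (r i) <= k by rewrite kE le_bigmax.
have le_sigma i : degree (r i) <= sigma by rewrite sigmaE le_bigmax.
have k0 : 0 <= k by rewrite kE bigmax_ge_id.
have sigma0 : 0 <= sigma by rewrite sigmaE bigmax_ge_id.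
have lam0 : 0 <= 1 + k * xi sigma by rewrite addr_ge0 // mulr_ge0 // xi_ge0.
have cz0 i : 0 <= c i (human zEQ i) (auton zEQ i) by rewrite cE // latency_ge0.
have := equilibrium_variational alpha0 beta0 lam0 cz0 eqz feasq.
set V := \sum_i _ => variational.
have smooth : V - social_cost c qOPT <= k * xi sigma * social_cost c zEQ.
  rewrite /V /social_cost -sumrB mulr_sumr; apply: ler_sum => i _.
  by rewrite -mulrBl !cE // latency_increment_le.
by move: variational smooth; rewrite mulrDl mul1r; lra.
Qed.
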